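(* Let $\bm\mu_0,\bm\mu\in\mathbb{R}^d$, let $\bm\Sigma_0,\bm\Sigma$ be $d\times d$ (symmetric positive definite) covariance matrices, and let $\bm L$ be a $d\times d$ matrix with $\bm L\bm L^T=\bm\Sigma$. The likelihood ratio function $$W(\bm z)=\frac{\det(\bm\Sigma)^{1/2}}{\det(\bm\Sigma_0)^{1/2}}\exp\left\{\frac12\bm z^T\bm z-\frac12(\bm\mu-\bm\mu_0+\bm L\bm z)^T\bm\Sigma_0^{-1}(\bm\mu-\bm\mu_0+\bm L\bm z)\right\},\qquad \bm z\in\mathbb{R}^d,$$ satisfies the ''QMC-friendly'' boundary growth condition if and only if all the eigenvalues of the matrix $\bm L^T\bm\Sigma_0^{-1}\bm L$ are larger than or equal to $1$.
   Context: For $v\subseteq\{1,\dots,d\}$, $D_vG$ denotes the mixed partial derivative of a function $G$ taken once with respect to each $z_j$, $j\in v$, with $D_\emptyset G=G$. $\Phi$ is the standard normal CDF. QMC-friendly boundary growth condition for $G:\mathbb{R}^d\to\mathbb{R}$: for arbitrarily small $B_1,\dots,B_d>0$ there exists a constant $B>0$ (depending on the $B_i$) such that for every $v\subseteq\{1,\dots,d\}$ and all $\bm z\in\mathbb{R}^d$, $$|(D_vG)(\bm z)|\le B\prod_{i=1}^d[1-\Phi(|z_i|)]^{-B_i}.$$ *)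

(* Defs.v *)
From mathcomp Require Import all_boot all_order all_algebra.
From mathcomp Require Import all_classical all_reals all_analysis.

Set Implicit Arguments.
Unset Strict Implicit.
Unset Printing Implicit Defensive.

Import Order.TTheory GRing.Theory Num.Theory.
Import numFieldNormedType.Exports.

Local Open Scope classical_set_scope.
Local Open Scope ring_scope.

Definition std_normal_cdf (R : realType) (x : R) : R :=
  fine (normal_prob 0 1 `]-oo, x]).

Definition partial (R : realType) (d : nat) (j : 'I_d)
    (G : 'cV[R]_d -> R) (z : 'cV[R]_d) : R :=
  'D_(delta_mx j 0) G z.

Definition iter_partial (R : realType) (d : nat) (s : seq 'I_d)
    (G : 'cV[R]_d -> R) : 'cV[R]_d -> R :=
  foldr (@partial R d) G s.

(* ['D_v G] is a total operator with a junk value where the limit does not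
   exist, so the existence of every derivative is recorded separately. *)
Fixpoint iter_partial_exists (R : realType) (d : nat) (s : seq 'I_d)
    (G : 'cV[R]_d -> R) : Prop :=
  if s is j :: s' then
    iter_partial_exists s' G /\
    forall z : 'cV[R]_d, derivable (iter_partial s' G) z (delta_mx j 0)
  else True.

(* The variables of [v] are differentiated once each, in the order of
   [enum v], the largest index first. *)
Definition mixed_partial (R : realType) (d : nat) (v : {set 'I_d})
    (G : 'cV[R]_d -> R) : 'cV[R]_d -> R :=
  iter_partial (enum v) G.

Definition mixed_partial_exists (R : realType) (d : nat) (v : {set 'I_d})
    (G : 'cV[R]_d -> R) : Prop :=
  iter_partial_exists (enum v) G.

(* "For arbitrarily small b_i" is rendered as "for all b_i > 0": since
   0 < 1 - Phi < 1, a bound for given exponents yields it for larger ones. *)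
Definition qmc_friendly_growth (R : realType) (d : nat)
    (G : 'cV[R]_d -> R) : Prop :=
  (forall v : {set 'I_d}, mixed_partial_exists v G) /\
  forall b : 'I_d -> R, (forall i, 0 < b i) ->
  exists B : R, 0 < B /\
    forall (v : {set 'I_d}) (z : 'cV[R]_d),
      `|mixed_partial v G z| <=
        B * \prod_(i < d) (1 - std_normal_cdf `|z i 0|) `^ (- b i).

Definition posdefmx (R : realType) (d : nat) (S : 'M[R]_d) : Prop :=
  S \is symmetricmx /\
  forall x : 'cV[R]_d, x != 0 -> 0 < (x^T *m S *m x) 0 0.

Definition likelihood_ratio (R : realType) (d : nat) (mu0 mu : 'cV[R]_d)
    (Sigma0 Sigma L : 'M[R]_d) (z : 'cV[R]_d) : R :=
  let y := mu - mu0 + L *m z in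
  Num.sqrt (\det Sigma) / Num.sqrt (\det Sigma0) *
  expR (2^-1 * (z^T *m z) 0 0 - 2^-1 * (y^T *m invmx Sigma0 *m y) 0 0).

(* Main.v *)
(* Up to a positive constant, W is the exponential of
   (z^T z - z^T M z) / 2 + (affine function of z), where M = L^T Sigma0^-1 L.
   The tail 1 - Phi(|x|) lies between constant multiples of
   exp (- (|x| + 1)^2 / 2) and exp (- x^2 / 2), so the growth condition asks for
   a bound by exp (eps z^T z) for every eps > 0. If M >= 1, the quadratic part
   is nonpositive; every mixed partial derivative is a polynomial times W, and both
   the polynomial and the exponential of the affine part are absorbed by
   exp (eps z^T z). If M has an eigenvalue a < 1, then W grows like
   exp ((1 - a) |z|^2 / 2) along an eigenvector, which violates the condition
   for small exponents, already without derivatives. *)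

Require Import Defs.
From mathcomp Require Import all_boot all_order all_algebra.
From mathcomp Require Import all_classical all_reals all_analysis.
From mathcomp Require Import measurable_realfun.
From mathcomp Require Import ring lra.
Import Order.TTheory GRing.Theory Num.Theory.
Import numFieldNormedType.Exports.
Local Open Scope ring_scope.

Set Implicit Arguments.
Unset Strict Implicit.
Unset Printing Implicit Defensive.

(** * Quadratic forms, positive definiteness and least eigenvalues *)

Lemma posdefmx_trmx (R : realType) (d : nat) (S : 'M[R]_d) :
  posdefmx S -> S^T = S.
Proof.
by case=> /is_hermitianmxP hS _; rewrite [in RHS]hS expr0 scale1r map_mx_id.
Qed.

Lemma qform_scalar (R : realType) (d : nat) (a : R) (x : 'cV[R]_d) :
  (x^T *m a%:M *m x) 0 0 = a * (x^T *m x) 0 0.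
Proof. by rewrite mul_mx_scalar -scalemxAl mxE. Qed.

Lemma qformD (R : realType) (d : nat) (A B : 'M[R]_d) (x : 'cV[R]_d) :
  (x^T *m (A + B) *m x) 0 0 = (x^T *m A *m x) 0 0 + (x^T *m B *m x) 0 0.
Proof. by rewrite mulmxDr mulmxDl mxE. Qed.

Lemma qformZ (R : realType) (d : nat) (a : R) (A : 'M[R]_d) (x : 'cV[R]_d) :
  (x^T *m (a *: A) *m x) 0 0 = a * (x^T *m A *m x) 0 0.
Proof. by rewrite -scalemxAr -scalemxAl mxE. Qed.

Lemma normsqE (R : realType) (d : nat) (x : 'cV[R]_d) :
  (x^T *m x) 0 0 = \sum_i x i 0 ^+ 2.
Proof. by rewrite mxE; apply: eq_bigr => i _; rewrite mxE expr2. Qed.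

Lemma normsq_ge0 (R : realType) (d : nat) (x : 'cV[R]_d) : 0 <= (x^T *m x) 0 0.
Proof. by rewrite normsqE sumr_ge0// => i _; rewrite sqr_ge0. Qed.

Lemma normsq_gt0 (R : realType) (d : nat) (x : 'cV[R]_d) :
  x != 0 -> 0 < (x^T *m x) 0 0.
Proof.
move=> x0; rewrite lt0r normsq_ge0 andbT; apply: contra x0.
rewrite normsqE psumr_eq0 => [/allP h|i _]; last exact: sqr_ge0.
apply/eqP/matrixP => i j; rewrite ord1 mxE.
by have := h i (mem_index_enum _); rewrite /= sqrf_eq0 => /eqP.
Qed.

(** A row vector [v] with [v S = 0] makes the form vanish at [v^T]. Symmetry is left out, so that
    points of a segment of matrices only need the inequality. *)
Lemma posdefmx_unit (R : realType) (d : nat) (S : 'M[R]_d) :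
  (forall x : 'cV[R]_d, x != 0 -> 0 < (x^T *m S *m x) 0 0) -> S \in unitmx.
Proof.
move=> hS; rewrite -row_free_unit -kermx_eq0; apply/rowV0P => v /sub_kermxP vS.
apply/eqP; apply: contraT => v0.
by have := hS v^T; rewrite trmx_eq0 trmxK vS mul0mx mxE ltxx => /(_ v0).
Qed.

(* The determinant cannot vanish along the segment from the identity to [S]. *)
Lemma posdefmx_det_gt0 (R : realType) (d : nat) (S : 'M[R]_d) :
  posdefmx S -> 0 < \det S.
Proof.
case=> _ hS.
(* Writing the determinant along the segment as a polynomial in the parameter lets the intermediate
   value theorem for polynomials apply. *)
pose p : {poly R} :=
  \det ((1 - 'X)%:M + 'X *: map_mx (@polyC R) S : 'M[{poly R}]_d).
have pE t : p.[t] = \det ((1 - t)%:M + t *: S).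
  rewrite /p -horner_evalE -det_map_mx; congr (\det _).
  apply/matrixP => i j; rewrite !mxE /= horner_evalE !hornerE.
  by rewrite hornerMn !hornerE.
have p_neq0 t : 0 <= t <= 1 -> p.[t] != 0.
  move=> /andP[t0 t1]; rewrite pE -unitfE -unitmxE.
  apply: posdefmx_unit => x x0.
  rewrite qformD qform_scalar qformZ.
  have Sx := hS x x0; have xx := normsq_gt0 x0.
  have [->|t_neq1] := eqVneq t 1; first by rewrite subrr mul0r add0r mul1r.
  rewrite ltr_pwDl// ?mulr_gt0// ?mulr_ge0// ?ltW//.
  by rewrite subr_gt0 lt_neqAle t_neq1.
rewrite ltNge; apply/negP => detS.
(* If [\det S <= 0], then [- p] goes from [-1] at 0 to a nonnegative value at 1, hence has a root in
   between. *)
have [||t t01 pt] := @poly_ivt R (- p) 0 1.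
- exact: ler01.
- rewrite !hornerN !pE subr0 scale0r addr0 det1 subrr scale1r oppr_le0 ler01 /=.
  by rewrite raddf0 add0r oppr_ge0.
have := p_neq0 t t01.
by move: pt; rewrite /root hornerN oppr_eq0 => ->.
Qed.

(** Each product [|x_i x_j|] is at most [|x|^2], so the sum of the absolute values of the entries
    suffices; the added 1 only makes [K] positive. *)
Lemma qform_bounded (R : realType) (d : nat) (A : 'M[R]_d) :
  exists2 K : R, 0 < K &
    forall x : 'cV[R]_d, `|(x^T *m A *m x) 0 0| <= K * (x^T *m x) 0 0.
Proof.
have s0 : 0 <= \sum_i \sum_j `|A i j|.
  by rewrite sumr_ge0// => i _; rewrite sumr_ge0.
exists (1 + \sum_i \sum_j `|A i j|) => [|x].
  by rewrite ltr_pwDl.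
have le_normsq i : x i 0 ^+ 2 <= (x^T *m x) 0 0.
  by rewrite normsqE (bigD1 i)//= lerDl sumr_ge0// => j _; rewrite sqr_ge0.
apply: (@le_trans _ _ ((\sum_i \sum_j `|A i j|) * (x^T *m x) 0 0)); last first.
  by rewrite ler_wpM2r ?normsq_ge0// lerDr.
move: {s0} le_normsq; move: ((x^T *m x) 0 0) => n le_normsq.
rewrite -mulmxA mxE mulr_suml; apply: le_trans (ler_norm_sum _ _ _) _.
apply: ler_sum => i _; rewrite !mxE mulr_sumr mulr_suml.
apply: le_trans (ler_norm_sum _ _ _) _; apply: ler_sum => j _.
rewrite mulrCA normrM ler_wpM2l// normrM.
have := le_normsq i; have := le_normsq j.
rewrite -(real_normK (num_real (x i 0))) -(real_normK (num_real (x j 0))).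
have := sqr_ge0 (`|x i 0| - `|x j 0|); rewrite sqrrB.
move: `|x i 0| `|x j 0| => a b.
by rewrite mulr2n; lra.
Qed.

(* For [t = 1 / K], expand [0 <= (x - t A x)^T A (x - t A x)]. *)
Lemma psd_unit_coercive (R : realType) (d : nat) (A : 'M[R]_d) :
  A^T = A -> A \in unitmx ->
  (forall x : 'cV[R]_d, 0 <= (x^T *m A *m x) 0 0) ->
  exists2 K : R, 0 < K &
    forall x : 'cV[R]_d, (x^T *m x) 0 0 <= K * (x^T *m A *m x) 0 0.
Proof.
move=> At Au psd.
have [K K0 hK] := qform_bounded A.
have [K' K'0 hK'] := qform_bounded ((invmx A)^T *m invmx A).
exists (K' * K) => [|x]; first exact: mulr_gt0.
(* Since [x] is the image of [A x] under the inverse, [|x|^2 <= K' |A x|^2]; it remains to show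
   [|A x|^2 <= K x^T A x]. *)
have inv_bd : (x^T *m x) 0 0 <= K' * ((A *m x)^T *m (A *m x)) 0 0.
  have := hK' (A *m x); rewrite trmx_mul !mulmxA mulmxKV//.
  rewrite trmx_inv mulmxK ?unitmx_tr//.
  by apply: le_trans; exact: ler_norm.
apply: le_trans inv_bd _; rewrite -mulrA ler_pM2l//.
have := psd (x - K^-1 *: (A *m x)).
have := le_trans (ler_norm _) (hK (A *m x)).
rewrite [(_ - _)^T]linearB /= [(_ *: _)^T]linearZ /= !mulmxBl !mulmxBr.
rewrite -!scalemxAl -!scalemxAr.
rewrite ?trmx_mul ?At ?mulmxA.
have BE (u v : 'M[R]_1) : (u - v) 0 0 = u 0 0 - v 0 0 by rewrite !mxE.
have ZE (k : R) (u : 'M[R]_1) : (k *: u) 0 0 = k * u 0 0 by rewrite mxE.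
rewrite !(BE, ZE).
set n := (x^T *m A *m A *m x) 0 0; set a := (x^T *m A *m x) 0 0.
set m := (x^T *m A *m A *m A *m x) 0 0 => mn h.
have : K * (K^-1 * (K^-1 * m)) <= K * (K^-1 * (K^-1 * (K * n))).
  by rewrite !ler_pM2l ?invr_gt0.
have := K0; rewrite -invr_gt0 => Ki.
have KK : K * K^-1 = 1 by rewrite divff ?gt_eqF.
have -> : K * (K^-1 * (K^-1 * (K * n))) = n.
  by rewrite !mulrA KK mul1r mulVf ?gt_eqF// mul1r.
have : 0 <= K * (a - K^-1 * n - (K^-1 * n - K^-1 * (K^-1 * m))).
  by rewrite mulr_ge0// ltW.
rewrite !mulrBr !mulrA KK !mul1r; lra.
Qed.

(* The supremum of the [t] with [t |x|^2 <= x^T M x] for all [x] is an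
   eigenvalue, which avoids the spectral theorem: otherwise
   [psd_unit_coercive] would allow a larger [t]. *)
Lemma symmetric_eigenvalue_ge1 (R : realType) (d : nat) (M : 'M[R]_d) :
  M^T = M -> (forall a, eigenvalue M a -> 1 <= a) ->
  forall x : 'cV[R]_d, (x^T *m x) 0 0 <= (x^T *m M *m x) 0 0.
Proof.
(* In dimension 0 both sides are 0, while every [t] would satisfy the inequality defining [T],
   leaving no supremum to use. *)
case: d => [|d] in M *; first by move=> _ _ x; rewrite !mxE !big_ord0.
move=> Mt hM.
have [K K0 hK] := qform_bounded M.
pose T := [set t : R |
  forall x : 'cV[R]_d.+1, t * (x^T *m x) 0 0 <= (x^T *m M *m x) 0 0]%classic.
have TNK : T (- K).
  by move=> x; have := hK x; rewrite ler_norml mulNr => /andP[].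
have ubT : has_ubound T.
  pose e : 'cV[R]_d.+1 := delta_mx ord0 0.
  exists K => t /(_ e) Tt.
  have n1 : 0 < (e^T *m e) 0 0.
    apply: normsq_gt0; apply/negP => /eqP/matrixP/(_ ord0 0).
    by rewrite !mxE !eqxx => /eqP; rewrite oner_eq0.
  rewrite -(ler_pM2r n1); apply: le_trans Tt _.
  exact: le_trans (ler_norm _) (hK _).
have hs : has_sup T by split; first exists (- K).
have Ts : T (sup T).
  move=> x; have [->|x0] := eqVneq x 0.
    by rewrite mulmx0 mulmx0 mxE mulr0.
  rewrite -ler_pdivlMr ?normsq_gt0//; apply: ge_sup; first by exists (- K).
  by move=> t Tt; rewrite ler_pdivlMr ?normsq_gt0.
suff : eigenvalue M (sup T).
  move=> /hM s1 x; apply: le_trans (Ts x).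
  by rewrite -{1}[(_ *m x) 0 0]mul1r ler_wpM2r ?normsq_ge0.
apply: contraT.
rewrite /eigenvalue negbK /eigenspace kermx_eq0 row_free_unit => Nu.
have Nt : (M - (sup T)%:M)^T = M - (sup T)%:M.
  by rewrite linearB /= Mt tr_scalar_mx.
have NE (x : 'cV[R]_d.+1) : (x^T *m (M - (sup T)%:M) *m x) 0 0 =
    (x^T *m M *m x) 0 0 - sup T * (x^T *m x) 0 0.
  by rewrite qformD -raddfN qform_scalar mulNr.
have [|C C0 hC] := psd_unit_coercive Nt Nu.
  by move=> x; rewrite NE subr_ge0; exact: Ts.
have : T (sup T + C^-1).
  move=> x; rewrite mulrDl -lerBrDl -NE mulrC ler_pdivrMr// mulrC; exact: hC.
by move=> /(ub_le_sup ubT); rewrite gerDl leNgt invr_gt0 C0.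
Qed.

(** * Two-sided Gaussian tail bounds *)

Lemma std_normal_cdf_tail (R : realType) (x : R) :
  (1 - std_normal_cdf x)%:E = normal_prob 0 1 `]x, +oo[%classic.
Proof.
have -> : `]x, +oo[%classic = (~` `]-oo, x])%classic by rewrite setCitvl.
rewrite probability_setC//= /std_normal_cdf EFinB fineK//.
by rewrite fin_num_measure.
Qed.

(* For [0 <= x <= t], [t ^ 2 >= x ^ 2 + (t - x) ^ 2], so the tail is at most
   [exp (- x ^ 2 / 2)] times a probability of the normal law centred at [x]. *)
Lemma std_normal_tail_le (R : realType) (x : R) :
  0 <= x -> 1 - std_normal_cdf x <= expR (- (x ^+ 2 / 2)).
Proof.
move=> x0; rewrite -lee_fin std_normal_cdf_tail.
have shift_sq (t : R) : x < t ->
    - t ^+ 2 / 2 <= - (x ^+ 2 / 2) + - (t - x) ^+ 2 / 2.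
  move=> xt; have : 0 <= x * (t - x) by rewrite mulr_ge0// subr_ge0 ltW.
  by lra.
apply: (@le_trans _ _
  ((expR (- (x ^+ 2 / 2)))%:E * normal_prob x 1 `]x, +oo[%classic)%E).
  rewrite /normal_prob -ge0_integralZl//; last 2 first.
  - apply/measurable_EFinP; apply: measurable_funTS;
    exact: measurable_normal_pdf.
  - by move=> t _; rewrite lee_fin normal_pdf_ge0.
  apply: ge0_le_integral => //.
  - by move=> t _; rewrite lee_fin normal_pdf_ge0.
  - apply/measurable_EFinP; apply: measurable_funTS;
    exact: measurable_normal_pdf.
  - by apply: measurable_funeM;
      apply/measurable_EFinP; apply: measurable_funTS;
    exact: measurable_normal_pdf.
  move=> t /=; rewrite in_itv/= andbT => xt.
  rewrite lee_fin !normal_pdfE ?oner_eq0// mulrCA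
     ler_pM2l ?normal_peak_gt0 ?oner_eq0//.
  by rewrite /normal_fun -expRD ler_expR subr0 expr1n; exact: shift_sq.
by rewrite -[leRHS]mule1 lee_wpmul2l ?lee_fin ?expR_ge0 ?probability_le1.
Qed.

(** Only the mass of []x, x + 1]] is kept: this interval has length 1, and on it the density is at
    least its value at [x + 1]. *)
Lemma std_normal_tail_ge (R : realType) (x : R) :
  0 <= x -> normal_peak 1 * expR (- ((x + 1) ^+ 2 / 2)) <= 1 - std_normal_cdf x.
Proof.
move=> x0; rewrite -lee_fin std_normal_cdf_tail.
apply: (@le_trans _ _ (normal_prob 0 1 `]x, x + 1]%classic)); last first.
  by apply: le_measure; rewrite ?inE//=; apply: subset_itv; rewrite ?bnd_simp.
rewrite /normal_prob.
set c := normal_peak 1 * _.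
have <- :
    (\int[lebesgue_measure]_(t in `]x, (x + 1)%R]) c%:E = c%:E :> \bar R)%E.
  rewrite integral_cst//= lebesgue_measure_itv /= lte_fin ltrDl ltr01.
  by rewrite -EFinD addrAC subrr add0r mule1.
apply: ge0_le_integral => //.
- by move=> t _; rewrite lee_fin mulr_ge0 ?expR_ge0 ?normal_peak_ge0.
- apply/measurable_EFinP; apply: measurable_funTS;
    exact: measurable_normal_pdf.
move=> t /=; rewrite in_itv/= => /andP[xt tx1].
rewrite lee_fin normal_pdfE ?oner_eq0// ler_pM2l ?normal_peak_gt0 ?oner_eq0//.
rewrite /normal_fun ler_expR subr0 expr1n mulNr lerN2 -mulr_natr mul1r.
by rewrite ler_pM2r ?invr_gt0// ler_pXn2r ?nnegrE// ?addr_ge0//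
  ltW// (le_lt_trans x0).
Qed.

Lemma std_normal_tail_gt0 (R : realType) (x : R) :
  0 <= x -> 0 < 1 - std_normal_cdf x.
Proof.
move=> x0; apply: lt_le_trans (std_normal_tail_ge x0).
by rewrite mulr_gt0 ?expR_gt0 ?normal_peak_gt0 ?oner_eq0.
Qed.

Lemma tail_powR_ge (R : realType) (x b : R) : 0 < b ->
  expR (b / 2 * x ^+ 2) <= (1 - std_normal_cdf `|x|) `^ (- b).
Proof.
move=> b0; have tg := std_normal_tail_gt0 (normr_ge0 x).
rewrite /powR gt_eqF// ler_expR mulNr -mulrN mulrAC -mulrA ler_pM2l//.
have := std_normal_tail_le (normr_ge0 x).
rewrite -ler_ln ?posrE ?expR_gt0// expRK real_normK ?num_real// lerNr.
by rewrite mulrC.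
Qed.

(** The lower tail bound is combined with [(|x| + 1)^2 / 2 <= x^2 + 1], which is
    [(|x| - 1)^2 >= 0]. *)
Lemma tail_powR_le (R : realType) (x b : R) : 0 < b ->
  (1 - std_normal_cdf `|x|) `^ (- b) <=
  expR (b * (x ^+ 2 + 1 - ln (normal_peak 1))).
Proof.
move=> b0; have tg := std_normal_tail_gt0 (normr_ge0 x).
rewrite /powR gt_eqF// ler_expR mulNr -mulrN ler_pM2l//.
have pk : 0 < @normal_peak R 1 by rewrite normal_peak_gt0 ?oner_eq0.
have := std_normal_tail_ge (normr_ge0 x).
rewrite -ler_ln ?posrE ?mulr_gt0 ?expR_gt0// lnM ?posrE ?expR_gt0// expRK.
have := sqr_ge0 (`|x| - 1).
rewrite -(real_normK (num_real x)).
by move: (ln _) (ln _) => u v; lra.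
Qed.

(** * Polynomial functions, and their products with exponentials *)

Section PolynomialFunctions.
Variables (R : realType) (d : nat).
Implicit Types (p q : 'cV[R]_d -> R) (z : 'cV[R]_d).

(** Polynomials are encoded as functions with a construction history, so that differentiability,
    stability under [partial] and growth bounds all follow by induction. *)
Inductive polyfun : ('cV[R]_d -> R) -> Prop :=
| polyfun_cst c : polyfun (fun=> c)
| polyfun_coord i : polyfun (fun z => z i 0)
| polyfunD p q : polyfun p -> polyfun q -> polyfun (fun z => p z + q z)
| polyfunM p q : polyfun p -> polyfun q -> polyfun (fun z => p z * q z).

Lemma polyfunB p q : polyfun p -> polyfun q -> polyfun (fun z => p z - q z).
Proof.
move=> Pp Pq; rewrite (_ : (fun z => p z - q z) = (fun z => p z + -1 * q z)).
  by apply: polyfunD => //; apply: polyfunM => //; exact: polyfun_cst.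
by apply/funext => z; rewrite mulN1r.
Qed.

Lemma polyfun_sum (I : Type) (r : seq I) (F : I -> 'cV[R]_d -> R) :
  (forall i, polyfun (F i)) -> polyfun (fun z => \sum_(i <- r) F i z).
Proof.
move=> PF; elim: r => [|i r IH].
  under eq_fun do rewrite big_nil; exact: polyfun_cst.
by under eq_fun do rewrite big_cons; exact: polyfunD.
Qed.

Lemma polyfun_differentiable p : polyfun p -> forall z, differentiable p z.
Proof.
elim=> [c|i|{}p q _ Hp _ Hq|{}p q _ Hp _ Hq] z.
- exact: differentiable_cst.
- exact: differentiable_coord.
- exact: differentiableD.
- exact: differentiableM.
Qed.

Lemma partialD (j : 'I_d) p q :
  (forall z, differentiable p z) -> (forall z, differentiable q z) ->
  partial j (fun z => p z + q z) = (fun z => partial j p z + partial j q z).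
Proof.
by move=> dp dq; apply/funext => z; apply: deriveD; apply: diff_derivable.
Qed.

Lemma partialM (j : 'I_d) p q :
  (forall z, differentiable p z) -> (forall z, differentiable q z) ->
  partial j (fun z => p z * q z) =
    (fun z => p z * partial j q z + q z * partial j p z).
Proof.
by move=> dp dq; apply/funext => z; apply: deriveM; apply: diff_derivable.
Qed.

Lemma polyfun_partial (j : 'I_d) p : polyfun p -> polyfun (partial j p).
Proof.
elim=> [c|i|{}p q Pp Hp Pq Hq|{}p q Pp Hp Pq Hq].
- rewrite (_ : partial j _ = fun=> 0); first exact: polyfun_cst.
  by apply/funext => z; exact: derive_cst.
- rewrite (_ : partial j _ = fun=> (delta_mx j 0 : 'cV[R]_d) i 0).
    exact: polyfun_cst.
  apply/funext => z; rewrite -(derive_id z (delta_mx j 0)).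
  by rewrite derive_mx ?mxE//; exact: derivable_id.
- by rewrite partialD; [exact: polyfunD|exact: polyfun_differentiable..].
- rewrite partialM; [|exact: polyfun_differentiable..].
  by apply: polyfunD; exact: polyfunM.
Qed.

Lemma differentiable_expR_comp q z :
  differentiable q z -> differentiable (fun z => expR (q z)) z.
Proof.
move=> dq; apply: (@differentiable_comp _ _ _ _ q expR) => //.
exact/derivable1_diffP.
Qed.

Lemma partial_expR_comp (j : 'I_d) q : (forall z, differentiable q z) ->
  partial j (fun z => expR (q z)) = (fun z => partial j q z * expR (q z)).
Proof.
move=> dq; apply/funext => z; rewrite /partial.
rewrite deriveE; last exact: differentiable_expR_comp.
have de : differentiable (@expR R) (q z) by exact/derivable1_diffP.
rewrite (_ : (fun z => _) = expR \o q)// diff_comp//= diff1E//.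
rewrite derive1E derive_val.
by rewrite deriveE.
Qed.

Lemma polyfun_expR_partial (j : 'I_d) p q : polyfun p -> polyfun q ->
  exists2 p', polyfun p' &
    partial j (fun z => p z * expR (q z)) = (fun z => p' z * expR (q z)).
Proof.
move=> Pp Pq.
exists (fun z => p z * partial j q z + partial j p z).
  by apply: polyfunD; [apply: polyfunM => //|]; exact: polyfun_partial.
have dq := polyfun_differentiable Pq.
rewrite partialM; [|exact: polyfun_differentiable|]; last first.
  by move=> z; exact: differentiable_expR_comp.
by rewrite partial_expR_comp//; apply/funext => z; ring.
Qed.

(** Existence and shape go together: the derivative already reached is a polynomial times [expR q],
    hence differentiable, so the next one exists and has the same shape. *)
Lemma polyfun_expR_iter_partial (s : seq 'I_d) p q : polyfun p -> polyfun q ->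
  iter_partial_exists s (fun z => p z * expR (q z)) /\
  exists2 p', polyfun p' &
    iter_partial s (fun z => p z * expR (q z)) = (fun z => p' z * expR (q z)).
Proof.
move=> Pp Pq; elim: s => [|j s [IH1 [r Pr IH2]]]; first by split=> //; exists p.
split=> /=; last by rewrite IH2; exact: polyfun_expR_partial.
split=> // z; rewrite IH2; apply: diff_derivable.
apply: differentiableM; first exact: polyfun_differentiable.
exact/differentiable_expR_comp/polyfun_differentiable.
Qed.

(** The induction keeps [e] general because a product gives [e / 2] to each factor. *)
Lemma polyfun_bound p (e : R) : polyfun p -> 0 < e ->
  exists2 C : R, 0 < C & forall z, `|p z| <= C * expR (e * (z^T *m z) 0 0).
Proof.
move=> Pp; elim: Pp e => [c|i|{}p q _ Hp _ Hq|{}p q _ Hp _ Hq] e e0.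
- exists (`|c| + 1) => [|z]; first by rewrite ltr_wpDl.
  apply: (@le_trans _ _ ((`|c| + 1) * 1)); first by rewrite mulr1 lerDl.
  rewrite ler_wpM2l ?addr_ge0// -expR0 ler_expR.
  by rewrite mulr_ge0 ?normsq_ge0// ltW.
- exists (1 + e^-1) => [|z]; first by rewrite addr_gt0// invr_gt0.
  have h : (z i 0) ^+ 2 <= (z^T *m z) 0 0.
    by rewrite normsqE (bigD1 i)//= lerDl sumr_ge0// => j _; rewrite sqr_ge0.
  have n0 := normsq_ge0 z.
  move: ((z^T *m z) 0 0) h n0 => n h n0.
  (* The factor [1 + e^-1] makes the expansion contain [1 + n], which dominates [|z_i|]; then
     [1 + e n <= expR (e n)]. *)
  apply: (@le_trans _ _ ((1 + e^-1) * (1 + e * n))); last first.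
    by rewrite ler_wpM2l ?expR_ge1Dx// addr_ge0// invr_ge0 ltW.
  have -> : (1 + e^-1) * (1 + e * n) = 1 + e^-1 + e * n + n.
    by field; rewrite gt_eqF.
  have : 0 <= e^-1 by rewrite invr_ge0 ltW.
  have : 0 <= e * n by rewrite mulr_ge0// ltW.
  have := sqr_ge0 (`|z i 0| - 1); rewrite sqrrB real_normK ?num_real//.
  move: h; rewrite expr1n mulr1 mulr2n.
  move: (z i 0 ^+ 2) `|z i 0| e^-1 => u v w.
  by lra.
- have [C C0 hC] := Hp e e0; have [D D0 hD] := Hq e e0.
  exists (C + D) => [|z]; first exact: addr_gt0.
  by apply: le_trans (ler_normD _ _) _; rewrite mulrDl lerD.
- have e20 : 0 < e / 2 by rewrite divr_gt0.
  have [C C0 hC] := Hp _ e20; have [D D0 hD] := Hq _ e20.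
  exists (C * D) => [|z]; first exact: mulr_gt0.
  by rewrite normrM [e]splitr mulrDl expRD mulrACA ler_pM//.
Qed.

End PolynomialFunctions.

(** * Quadratic forms of affine maps, and linear against quadratic growth *)

Lemma polyfun_qform (R : realType) (d n : nat) (A : 'M[R]_n)
    (f : 'cV[R]_d -> 'cV[R]_n) :
  (forall i, polyfun (fun z => f z i 0)) ->
  polyfun (fun z => ((f z)^T *m A *m f z) 0 0).
Proof.
move=> Pf; under eq_fun do rewrite mxE; apply: polyfun_sum => j.
apply: polyfunM => //; under eq_fun do rewrite mxE; apply: polyfun_sum => i.
by under eq_fun do rewrite mxE; apply: polyfunM => //; exact: polyfun_cst.
Qed.

Lemma qform_affine (R : realType) (d : nat) (S L : 'M[R]_d) (a z : 'cV[R]_d) :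
  S^T = S ->
  ((a + L *m z)^T *m S *m (a + L *m z)) 0 0 =
  (a^T *m S *m a) 0 0 + 2 * (a^T *m S *m L *m z) 0 0
  + (z^T *m (L^T *m S *m L) *m z) 0 0.
Proof.
move=> St; rewrite [(a + _)^T]linearD /= trmx_mul !mulmxDl !mulmxDr !mulmxA.
have DE (u v : 'M[R]_1) : (u + v) 0 0 = u 0 0 + v 0 0 by rewrite mxE.
have -> : z^T *m L^T *m S *m a = (a^T *m S *m L *m z)^T.
  by rewrite !trmx_mul trmxK St !mulmxA.
by rewrite !DE [_^T _ _]mxE; ring.
Qed.

(** Young's inequality in each coordinate: [|w_i z_i| <= w_i^2 / (4 e) + e z_i^2]. *)
Lemma linear_form_le (R : realType) (d : nat) (w : 'rV[R]_d) (e : R) : 0 < e ->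
  exists C : R, forall z : 'cV[R]_d, `|(w *m z) 0 0| <= C + e * (z^T *m z) 0 0.
Proof.
move=> e0; exists (\sum_i w 0 i ^+ 2 / (4 * e)) => z.
rewrite mxE normsqE mulr_sumr -big_split /=.
apply: le_trans (ler_norm_sum _ _ _) _; apply: ler_sum => i _.
have e4 : 0 < 4 * e by rewrite mulr_gt0.
rewrite -(ler_pM2l e4) mulrDr mulrCA divff ?gt_eqF// mulr1.
rewrite normrM -(real_normK (num_real (w 0 i))).
rewrite -(real_normK (num_real (z i 0))).
move: `|w 0 i| `|z i 0| => u v.
by have := sqr_ge0 (u - 2 * e * v); lra.
Qed.

Lemma quadratic_unbounded (R : realType) (A b K : R) : 0 < A ->
  ~ (forall t, A * t ^+ 2 - b * t <= K).
Proof.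
move=> A0 hK.
have K0 : 0 <= K by have := hK 0; rewrite expr0n/= !mulr0 subrr.
(* Adding the bounds at two opposite points cancels the linear term and leaves
   [A + 2 K + K^2 / A <= K], impossible for [A > 0] and [K >= 0]. *)
have := hK (1 + K / A); have := hK (- (1 + K / A)).
have -> : A * (- (1 + K / A)) ^+ 2 = A + 2 * K + K * (K / A).
  by field; rewrite gt_eqF.
have -> : A * (1 + K / A) ^+ 2 = A + 2 * K + K * (K / A).
  by field; rewrite gt_eqF.
have : 0 <= K * (K / A) by rewrite mulr_ge0// divr_ge0// ltW.
by move: (K * (K / A)) (K / A) => u v; lra.
Qed.

(** * Growth of the likelihood ratio *)

Section LikelihoodRatio.
Variables (R : realType) (d : nat) (mu0 mu : 'cV[R]_d).
Variables (Sigma0 Sigma L : 'M[R]_d).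
Hypotheses (hSigma0 : posdefmx Sigma0) (hSigma : posdefmx Sigma).

Let S := invmx Sigma0.
Let M := L^T *m S *m L.
Let W := likelihood_ratio mu0 mu Sigma0 Sigma L.
Let c := Num.sqrt (\det Sigma) / Num.sqrt (\det Sigma0).
Let q (z : 'cV[R]_d) :=
  2^-1 * (z^T *m z) 0 0
  - 2^-1 * ((mu - mu0 + L *m z)^T *m S *m (mu - mu0 + L *m z)) 0 0.

Lemma invmx_Sigma0_trmx : S^T = S.
Proof. by rewrite /S trmx_inv posdefmx_trmx. Qed.

Lemma LSL_trmx : M^T = M.
Proof. by rewrite /M !trmx_mul trmxK invmx_Sigma0_trmx mulmxA. Qed.

Lemma ratio_const_gt0 : 0 < c.
Proof. by rewrite divr_gt0// sqrtr_gt0 posdefmx_det_gt0. Qed.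

Lemma ratio_exponentE z : q z =
  2^-1 * ((z^T *m z) 0 0 - (z^T *m M *m z) 0 0)
  - ((mu - mu0)^T *m S *m L *m z) 0 0
  - 2^-1 * ((mu - mu0)^T *m S *m (mu - mu0)) 0 0.
Proof.
rewrite /q qform_affine ?invmx_Sigma0_trmx// -/M.
by field.
Qed.

Lemma polyfun_ratio_exponent : polyfun q.
Proof.
apply: polyfunB; apply: polyfunM; try exact: polyfun_cst.
  under eq_fun do rewrite -[_^T]mulmx1.
  by apply: polyfun_qform => i; exact: polyfun_coord.
apply: polyfun_qform => i; under eq_fun do rewrite !mxE.
apply: polyfunD; first exact: polyfun_cst.
by apply: polyfun_sum => j; apply: polyfunM;
  [exact: polyfun_cst|exact: polyfun_coord].
Qed.

Lemma growth_of_eigenvalues :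
  (forall a : R, eigenvalue M a -> 1 <= a) -> qmc_friendly_growth W.
Proof.
move=> hM.
have iterW s :=
  polyfun_expR_iter_partial s (polyfun_cst d c) polyfun_ratio_exponent.
have nM := symmetric_eigenvalue_ge1 LSL_trmx hM.
split=> [v|b b0]; first by have [] := iterW (enum v).
have [e e0 eb] : exists2 e : R, 0 < e & forall i, e <= b i.
  (* The default value 1 keeps the minimum positive even when [d = 0]. *)
  exists (\big[Num.min/1]_i b i); last by move=> i; exact: bigmin_le_cond.
  by apply/bigmin_gtP; split.
(* The product of tail powers supplies [e / 2]: one [e / 4] absorbs the linear term of the exponent,
   the other the polynomial factor. *)
have e4 : 0 < e / 4 by rewrite divr_gt0.
have [D hD] := linear_form_le ((mu - mu0)^T *m S *m L) e4.
pose K := D - 2^-1 * ((mu - mu0)^T *m S *m (mu - mu0)) 0 0.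
have q_le z : q z <= K + e / 4 * (z^T *m z) 0 0.
  rewrite ratio_exponentE /K; have := hD z; rewrite ler_norml => /andP[+ _].
  by have := nM z; move: ((z^T *m M *m z) 0 0) ((z^T *m z) 0 0) => m n; lra.
have prod_ge (z : 'cV[R]_d) : expR (e / 2 * (z^T *m z) 0 0) <=
    \prod_(i < d) (1 - std_normal_cdf `|z i 0|) `^ (- b i).
  rewrite normsqE mulr_sumr expR_sum; apply: ler_prod => i _.
  rewrite expR_ge0 /=; apply: le_trans (tail_powR_ge (z i 0) (b0 i)).
  by rewrite ler_expR ler_wpM2r ?sqr_ge0// ler_pM2r// invr_gt0.
have /choice[B hB] : forall v : {set 'I_d}, exists B : R, 0 < B /\
    forall z, `|mixed_partial v W z| <=
      B * \prod_(i < d) (1 - std_normal_cdf `|z i 0|) `^ (- b i).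
  move=> v; have [_ [p Pp pE]] := iterW (enum v).
  have [C C0 hC] := polyfun_bound Pp e4.
  exists (C * expR K); split=> [|z]; first by rewrite mulr_gt0 ?expR_gt0.
  rewrite [mixed_partial v W](_ : _ = fun z => p z * expR (q z))// normrM.
  rewrite [`|expR _|]ger0_norm ?expR_ge0// -mulrA.
  apply: (@le_trans _ _ (C * (expR K * expR (e / 2 * (z^T *m z) 0 0)))).
    apply: (@le_trans _ _ (C * expR (e / 4 * (z^T *m z) 0 0) * expR (q z))).
      by rewrite ler_wpM2r ?expR_ge0.
    rewrite -mulrA ler_pM2l// -!expRD ler_expR.
    by have := q_le z; move: ((z^T *m z) 0 0) => n; lra.
  by rewrite !ler_pM2l ?expR_gt0.
(* There are finitely many [v], so the sum of the positive constants [B v] serves them all. *)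
exists (\sum_v B v); split=> [|v z].
  rewrite (bigD1 finset.set0)//= ltr_pwDl//; first by have [] := hB finset.set0.
  by apply: sumr_ge0 => v _; have [/ltW] := hB v.
apply: le_trans ((hB v).2 z) _; rewrite ler_wpM2r//.
  by rewrite prodr_ge0// => i _; exact: powR_ge0.
rewrite (bigD1 v)//= lerDl; apply: sumr_ge0 => u _.
by have [/ltW] := hB u.
Qed.

Lemma eigenvalues_of_growth :
  qmc_friendly_growth W -> forall a : R, eigenvalue M a -> 1 <= a.
Proof.
move=> [_ hW] a /eigenvalueP[v vM v0]; rewrite leNgt; apply/negP => a1.
(* Along the eigenvector the quadratic part of the exponent is [(1 - a) / 2 * t^2 n = 2 b t^2 n],
   while the tail bound allows only [b t^2 n]; the excess [b n t^2] is what [quadratic_unbounded]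
   rules out. *)
pose b := (1 - a) / 4.
have b0 : 0 < b by rewrite divr_gt0// subr_gt0.
have [B [B0 hB]] := hW (fun=> b) (fun=> b0).
pose n := (v^T^T *m v^T) 0 0.
have n0 : 0 < n by apply: normsq_gt0; rewrite trmx_eq0.
pose k := 1 - ln (@normal_peak R 1).
pose s := ((mu - mu0)^T *m S *m (mu - mu0)) 0 0.
(* The coefficients come from taking logarithms in [c * expR (q z) <= B * expR (b * (t^2 n + k d))]
   and gathering the terms in [t] on the left. *)
apply: (@quadratic_unbounded R (b * n) (((mu - mu0)^T *m S *m L *m v^T) 0 0)
  (ln B + b * k * d%:R - ln c + 2^-1 * s)); first exact: mulr_gt0.
move=> t; pose z := t *: v^T.
have zz : (z^T *m z) 0 0 = t ^+ 2 * n.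
  by rewrite /z [(_ *: _)^T]linearZ /= -scalemxAl -scalemxAr scalerA mxE expr2.
(* [eigenvalueP] yields a row vector with [v M = a v], so [M] is applied to [z^T] from the right. *)
have zMz : (z^T *m M *m z) 0 0 = a * (t ^+ 2 * n).
  have zM : z^T *m M = a *: z^T.
    by rewrite /z [(_ *: _)^T]linearZ /= trmxK -scalemxAl vM !scalerA mulrC.
  by rewrite zM -scalemxAl mxE zz.
have prod_le : \prod_(i < d) (1 - std_normal_cdf `|z i 0|) `^ (- b) <=
    expR (b * (t ^+ 2 * n + k * d%:R)).
  have -> : k * d%:R = \sum_(i < d) k by rewrite sumr_const card_ord mulr_natr.
  rewrite -zz normsqE -big_split /= mulr_sumr expR_sum; apply: ler_prod => i _.
  by rewrite powR_ge0 /= addrA; exact: tail_powR_le.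
have : c * expR (q z) <= B * expR (b * (t ^+ 2 * n + k * d%:R)).
  (* The empty set of variables gives the growth bound for [W] itself. *)
  apply: le_trans (ler_norm _) _; have := hB finset.set0 z.
  rewrite /mixed_partial enum_set0 => /le_trans; apply.
  by rewrite ler_pM2l.
move: (c) ratio_const_gt0 => c' c'0.
rewrite -ler_ln ?posrE ?mulr_gt0 ?expR_gt0//.
rewrite !lnM ?posrE ?expR_gt0// !expRK ratio_exponentE zz zMz.
rewrite -/s -scalemxAr mxE /b.
move: (ln c') (ln B) (_ 0 0) => lc lB w.
move: (n) (s) (k) (d%:R) (t ^+ 2) => n' s' k' d' t2.
by lra.
Qed.

End LikelihoodRatio.

Unset Implicit Arguments.

Theorem theorem3p4 (R : realType) (d : nat) (mu0 mu : 'cV[R]_d)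
    (Sigma0 Sigma L : 'M[R]_d)
    (hSigma0 : posdefmx Sigma0) (hSigma : posdefmx Sigma)
    (hL : L *m L^T = Sigma) :
  qmc_friendly_growth (likelihood_ratio mu0 mu Sigma0 Sigma L) <->
  (forall a : R, eigenvalue (L^T *m invmx Sigma0 *m L) a -> 1 <= a).
Proof.
split; first exact: eigenvalues_of_growth.
exact: growth_of_eigenvalues.
Qed.
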